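(* Every power series can be decomposed as a sum of countably many simple power series with several properties; more precisely: let $D \subsetneq \mathbb{C}^N$ be any logarithmically convex complete Reinhardt domain. Let $h=h_G$ be the support function of the convex domain in $\mathbb{R}^N$ given by its logarithmic image $G=\lambda(D)$, and let $PS_h$ denote the normalized effective domain of $h$. For any given countable dense subset $\mathcal{C}=\{\alpha^n\}$ of distinct elements of $PS_h$, the following holds. Every power series $g(z)=\sum c_J z^J$ with $D$ as its domain of convergence can be decomposed as a sum of countably many simple power series $\sigma_n(z)$ ($n\in\mathbb{N}_0$) such that: (i) the domain of convergence of each $\sigma_n$ is a simple logarithmically convex complete Reinhardt domain $D_n$ whose logarithmic image $\lambda(D_n)\subset\mathbb{R}^N$ is actually a wedge, i.e. the intersection of just two half-spaces bounded by hyperplanes whose normal vectors are the distinct elements $\alpha^n,\alpha^{n-1}$ belonging to the prescribed countable dense subset $\mathcal{C}$; (ii) the pair of half-spaces whose intersection gives the wedge $\lambda(D_n)$ are both supporting half-spaces of the convex domain $G$; thereby, the intersection of the $D_n$'s is precisely $D$; (iii) the largest open subset of $\mathbb{C}^N$ where all the $\sigma_n$'s converge absolutely is $D$, on which the $\sigma_n$'s render a decomposition of $g$ (into simple power series) in the sense that $\sum_{n=0}^{\infty}\sigma_n(z)=g(z)$ for all $z\in D$; here $\sigma_0$ is the constant term of $g$.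
   Context: Notation. $\mathbb{N}_0=\mathbb{N}\cup\{0\}$. $S_N$ is the unit sphere of the $l^1$-norm on $\mathbb{R}^N$ and $PS_N=\{x\in\mathbb{R}^N: x_1+\dots+x_N=1,\ x_j\ge 0 \text{ for all } j\}$. The domain of convergence of a power series $f(z)=\sum_{J\in\mathbb{N}_0^N} c_Jz^J$ is the interior of the set of points of $\mathbb{C}^N$ at which the series converges absolutely; all power series are assumed convergent, i.e. with non-empty domain of convergence. $\lambda(z)=(\log|z_1|,\dots,\log|z_N|)$, defined for $z$ with no zero coordinate; the logarithmic image $\lambda(D)$ is the image under $\lambda$ of the points of $D$ with no zero coordinate. A domain $D\subset\mathbb{C}^N$ is complete Reinhardt if it is a union of open polydiscs centered at the origin; it is logarithmically convex if $\lambda(D)\subset\mathbb{R}^N$ is convex. The support function of a convex set $G\subset\mathbb{R}^N$ is $h_G(u)=\sup\{\langle x,u\rangle: x\in G\}\in(-\infty,\infty]$; its normalized effective domain is $\{\alpha\in S_N: h_G(\alpha)\text{ is finite}\}$. For $G$ the logarithmic image of a logarithmically convex complete Reinhardt domain this set is contained in $PS_N$ and is denoted $PS_h$. The supporting half-space of $G$ with normal vector $\alpha\in PS_h$ is $\{s\in\mathbb{R}^N: \langle\alpha,s\rangle-h_G(\alpha)<0\}$. A logarithmically convex complete Reinhardt domain is simple if its logarithmic image is an intersection of finitely many half-spaces ($\mathbb{R}^N$ itself is also regarded as a half-space); a power series is simple if its domain of convergence is simple.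
   Formalization: In (ii), D is the interior of the intersection of the D_n's (the plain intersection can be larger, e.g. for the bidisc with (1,0) not in C); the wedge claims are for n ≥ 1 only, as σ_0 is constant; C is an infinite sequence, so PS_h is not a single point. *)

(* Defs.v *)
From mathcomp Require Import all_boot all_order all_algebra.
From mathcomp Require Import complex.
From mathcomp Require Import all_classical all_reals all_analysis.
From mathcomp Require summability.

Set Implicit Arguments.
Unset Strict Implicit.
Unset Printing Implicit Defensive.

Import Order.TTheory GRing.Theory Num.Theory.
Import numFieldNormedType.Exports.

Local Open Scope classical_set_scope.
Local Open Scope ring_scope.

(* The regular module R[i]^o, rather than R[i], carries the norm topology. *)
Notation CC R := (complex R)^o (only parsing).

Section PowerSeries.
Variables (R : realType) (N : nat).

Definition multi_index := {ffun 'I_N -> nat}.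

Definition power_series := multi_index -> CC R.

Implicit Types (c : power_series) (z : 'rV[CC R]_N) (J : multi_index).

Definition monomial z J : CC R := \prod_(j < N) z ord0 j ^+ J j.

(* esum's summable: the finite partial sums of the moduli are bounded. *)
Definition abs_conv_set c : set 'rV[CC R]_N :=
  [set z | summable [set: multi_index]
             (fun J => (Normc.normc (c J * monomial z J))%:E)].

(* The unordered sum, i.e. the limit over the directed set of finite sets of
   multi-indices; meaningful when the series converges at z. *)
Definition ps_sum c z : CC R :=
  summability.sum (fun J : multi_index => (c J * monomial z J : CC R)).

Definition domain_of_convergence c : set 'rV[CC R]_N := (abs_conv_set c)°.

Definition constant_term c : power_series :=
  fun J => if J == [ffun=> 0%N] then c J else 0.

End PowerSeries.

Section Reinhardt.
Variables (R : realType) (N : nat).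
Implicit Types (D : set 'rV[CC R]_N) (G : set 'rV[R]_N).

Definition domain D := [/\ D !=set0, open D & connected D].

Definition polydisc (r : 'rV[R]_N) : set 'rV[CC R]_N :=
  [set z | forall j, Normc.normc (z ord0 j) < r ord0 j].

Definition complete_reinhardt D :=
  domain D /\
  exists2 P : set 'rV[R]_N, (forall r, P r -> forall j, 0 < r ord0 j) &
    D = \bigcup_(r in P) polydisc r.

Definition log_map (z : 'rV[CC R]_N) : 'rV[R]_N :=
  \row_j ln (Normc.normc (z ord0 j)).

Definition log_image D : set 'rV[R]_N :=
  log_map @` [set z | D z /\ forall j, z ord0 j != 0].

Definition log_convex D :=
  convex_set (log_image D : set (convex_lmodType 'rV[R]_N)).

Definition dot (x y : 'rV[R]_N) : R := \sum_(j < N) x ord0 j * y ord0 j.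

Definition l1_sphere : set 'rV[R]_N :=
  [set x | \sum_(j < N) `|x ord0 j| = 1].

Definition support_function G (u : 'rV[R]_N) : \bar R :=
  ereal_sup [set (dot x u)%:E | x in G].

Definition normalized_effective_domain G : set 'rV[R]_N :=
  [set a | l1_sphere a /\ support_function G a \is a fin_num].

(* Half-spaces are open, as log-images of (open) domains require. *)
Definition open_half_space (a : 'rV[R]_N) (b : R) : set 'rV[R]_N :=
  [set s | dot a s < b].

Definition half_space (H : set 'rV[R]_N) :=
  H = setT \/ exists a b, a != 0 /\ H = open_half_space a b.

Definition supporting_half_space G (a : 'rV[R]_N) : set 'rV[R]_N :=
  [set s | ((dot a s)%:E - support_function G a < 0)%E].

Definition simple_domain D :=
  [/\ complete_reinhardt D, log_convex D &
    exists (m : nat) (H : 'I_m -> set 'rV[R]_N),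
      (forall i, half_space (H i)) /\ log_image D = \bigcap_i H i].

Definition simple_power_series (c : power_series R N) :=
  simple_domain (domain_of_convergence c).

Definition wedge_with_normals (a b : 'rV[R]_N) (W : set 'rV[R]_N) :=
  [/\ a != 0, b != 0, a != b &
    exists s t, W = open_half_space a s `&` open_half_space b t].

(* Intersection in the sense of domains of C^N.  The interior matters: a boundary
   point of G may lie in each of countably many open supporting half-spaces of
   G, so the set-theoretic intersection can be larger. *)
Definition domain_bigcap (E : nat -> set 'rV[CC R]_N) : set 'rV[CC R]_N :=
  (\bigcap_n E n)°.

Definition largest_open (P : set 'rV[CC R]_N -> Prop) D :=
  [/\ open D, P D & forall U, open U -> P U -> U `<=` D].

End Reinhardt.

(* Main.v *)
(* Write h_n for the value of the support function at alpha_n. The power series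
   v_n with coefficients (-1/2)^n exp(- h_n |J| - sum_j (J_j - |J| alpha_n,j)^2)
   has bounded terms at w exactly when <alpha_n, log|w|> <= h_n, so by Abel's
   lemma its domain of convergence is the supporting half-space with normal
   alpha_n. Let g' := g - g(0) + v_0 be cut into its single terms p_0, p_1, ...
   and put sigma_(n+1) := p_n + v_(n+1) - v_n. A single term does not affect
   convergence and the alternating signs exclude cancellation, so sigma_(n+1)
   converges exactly on the n-th wedge, while the sums telescope to
   g + v_n - (tail of g'), and v_n tends to 0 on D because the Gaussian factor
   bounds 2^n v_n uniformly in n. That the wedges intersect in D follows by
   separating a point from the closure of the logarithmic image. *)

Require Import Defs.
From mathcomp Require Import all_boot all_order all_algebra.
From mathcomp Require Import complex.
From mathcomp Require Import all_classical all_reals all_analysis.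
From mathcomp Require Import finmap ring lra.
From mathcomp Require summability.

Import Order.TTheory GRing.Theory Num.Theory.
Import numFieldNormedType.Exports.

Local Open Scope classical_set_scope.
Local Open Scope ring_scope.

Set Implicit Arguments.
Unset Strict Implicit.
Unset Printing Implicit Defensive.

#[local] Existing Instance summability.totally_filter.

(** * Unordered sums *)

Section ComplexModulus.
Context {R : realType}.
Implicit Types x y : CC R.
Import Normc.

Lemma normc_ge0 x : 0 <= normc x.
Proof. by case: x => a b; rewrite sqrtr_ge0. Qed.

Lemma normc_real (a : R) : normc (a%:C)%C = `|a|.
Proof. by rewrite /normc /= expr0n addr0 sqrtr_sqr. Qed.

Lemma normc_gt0 x : (0 < normc x) = (x != 0).
Proof.
rewrite lt_neqAle normc_ge0 andbT eq_sym; congr (~~ _).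
by apply/eqP/eqP => [/eq0_normc//|->]; rewrite normc0.
Qed.

Lemma normcX x n : normc (x ^+ n) = normc x ^+ n.
Proof. by elim: n => [|n IH]; rewrite ?expr0 ?normc1// !exprS normcM IH. Qed.

Lemma normc_prod (I : Type) (s : seq I) (P : pred I) (F : I -> CC R) :
  normc (\prod_(i <- s | P i) F i) = \prod_(i <- s | P i) normc (F i).
Proof. by apply: (big_morph _ (@normcM R) (normc1 R)). Qed.

Lemma le_normc_sum (I : Type) (s : seq I) (P : pred I) (F : I -> CC R) :
  normc (\sum_(i <- s | P i) F i) <= \sum_(i <- s | P i) normc (F i).
Proof.
elim/big_rec2: _ => [|i a b _ ab]; first by rewrite normc0.
by apply: (le_trans (le_normcD _ _)); rewrite lerD2l.
Qed.

Lemma normc_ltP x (e : R) : (`|x : CC R| < (e%:C)%C) = (normc x < e).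
Proof.
have -> : `|x : CC R| = ((normc x)%:C)%C by case: x.
exact: ltcR.
Qed.

(** The norm of [CC R] takes values in [R[i]], so radii of balls are complex numbers. Positivity
    forces a zero imaginary part, which allows real radii throughout. *)
Lemma gt0_realC (e : R[i]) : 0 < e -> exists2 d : R, 0 < d & e = (d%:C)%C.
Proof.
by case: e => a b; rewrite ltcE /= => /andP[/eqP -> a0]; exists a.
Qed.

Lemma realC_gt0 (e : R) : (0 < (e%:C)%C :> R[i]) = (0 < e).
Proof. exact: ltcR. Qed.

Lemma cvg_normcP (T : Type) (F : set_system T) (FF : Filter F) (f : T -> CC R) l :
  f x @[x --> F] --> l <->
  forall e : R, 0 < e -> \forall x \near F, normc (l - f x) < e.
Proof.
rewrite cvgrPdist_lt; split=> [fl e e0|fl e /gt0_realC[d d0 ->]].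
  by have := fl (e%:C)%C; rewrite realC_gt0 => /(_ e0); under eq_near do rewrite normc_ltP.
by under eq_near do rewrite normc_ltP; exact: fl.
Qed.

Lemma interior_normcP (N : nat) (A : set 'rV[CC R]_N) z : A° z <->
  exists2 e : R, 0 < e &
    forall w : 'rV[CC R]_N, (forall j, normc (z ord0 j - w ord0 j) < e) -> A w.
Proof.
rewrite /interior /= nbhs_ballP; split=> [[e /= /gt0_realC[d d0 ->] zA]|[e e0 zA]].
  exists d => // w zw; apply: zA; split; first by rewrite realC_gt0.
  by move=> i j; rewrite (ord1 i) /ball/= normc_ltP.
exists (e%:C)%C => /=; first by rewrite realC_gt0.
move=> w [_ zw]; apply: zA => j.
by have := zw ord0 j; rewrite /ball/= normc_ltP.
Qed.

End ComplexModulus.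

Section HasSum.
Context {I : choiceType}.
Import Normc.

Definition has_sum {K : numDomainType} {V : normedModType K} (x : I -> V) (l : V) :=
  summability.partial_sum x @ summability.totally --> l.

Lemma partial_sumE (V : zmodType) (x : I -> V) (A : {fset I}) :
  summability.partial_sum x A = \sum_(i <- A) x i.
Proof. by rewrite /summability.partial_sum big_seq_fsetE. Qed.

Section Normed.
Context {K : numFieldType} {V : normedModType K}.
Implicit Types x y : I -> V.

Lemma has_sum_unique x l : has_sum x l -> summability.sum x = l.
Proof. by move=> xl; apply: cvg_lim. Qed.

Lemma has_sumD x y l m : has_sum x l -> has_sum y m -> has_sum (x \+ y) (l + m).
Proof.
move=> xl ym; rewrite /has_sum.
have -> : summability.partial_sum (x \+ y) =
  summability.partial_sum x \+ summability.partial_sum y.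
  by apply/funext => A; rewrite /= !partial_sumE big_split.
exact: cvgD.
Qed.

Lemma has_sumZ a x l : has_sum x l -> has_sum (a \*: x) (a *: l).
Proof.
move=> xl; rewrite /has_sum.
have -> : summability.partial_sum (a \*: x) = a \*: summability.partial_sum x.
  by apply/funext => A; rewrite /= !partial_sumE scaler_sumr.
exact: cvgZr.
Qed.

Lemma has_sum_finite x (F : {fset I}) : (forall i, i \notin F -> x i = 0) ->
  has_sum x (\sum_(i <- F) x i).
Proof.
move=> x0; apply: cvg_near_cst; exists F => //= A FA.
rewrite partial_sumE (big_fsetID _ (mem F) A) /= [X in _ + X]big1_seq ?addr0; last first.
  by move=> i /andP[_]; rewrite !inE /= => /andP[_]; exact: x0.
rewrite (_ : [fset i in A | i \in F]%fset = F)//.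
by apply/fsetP => i; rewrite !inE /=; apply: andb_idl; exact: (fsubsetP FA).
Qed.

(** Passes from unordered to sequential limits: each finite set of indices lies in some [F m], hence
    in all later ones, so [F] tends to the filter [totally]. *)
Lemma has_sum_exhaust x l (F : nat -> {fset I}) : has_sum x l ->
  {homo F : m n / (m <= n)%N >-> (m `<=` n)%fset} -> (forall i, exists n, i \in F n) ->
  (\sum_(i <- F n) x i) @[n --> \oo] --> l.
Proof.
move=> xl Fmono Fcover.
suff FT : F n @[n --> \oo] `=>` summability.totally.
  under eq_fun do rewrite -partial_sumE.
  exact: (cvg_comp F _ FT xl).
move=> P [A _ AP].
have [m Am] : exists m, (A `<=` F m)%fset.
  have /choice[k Fk] := Fcover.
  exists (\max_(i <- A) k i)%N; apply/fsubsetP => i iA.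
  by apply: (fsubsetP (Fmono _ _ _)) (Fk i); exact: leq_bigmax_seq.
exists m => // n /= mn; apply: AP => /=; apply: fsubset_trans Am _; exact: Fmono.
Qed.

End Normed.

End HasSum.

Lemma ler_sum_subset {R : numDomainType} {I : eqType} (s t : seq I) (F : I -> R) :
  uniq s -> uniq t -> {subset s <= t} -> (forall i, 0 <= F i) ->
  \sum_(i <- s) F i <= \sum_(i <- t) F i.
Proof.
move=> us ut st F0; rewrite [leRHS](bigID (mem s)) /= -[leLHS]addr0.
apply: lerD; last exact: sumr_ge0.
rewrite -[leRHS]big_filter (perm_big [seq i <- t | i \in s])//.
apply: uniq_perm => //; first exact: filter_uniq.
by move=> i; rewrite mem_filter; case: (boolP (i \in s)) => //= /st ->.
Qed.

Section AbsoluteSums.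
Context {R : realType} {I : choiceType}.
Import Normc.

(** The sum is the supremum of the finite partial sums, which increase with the index set. *)
Lemma has_sum_nonneg (x : I -> R) (M : R) : (forall i, 0 <= x i) ->
  (forall F : {fset I}, \sum_(i <- F) x i <= M) -> exists l, has_sum x l.
Proof.
move=> x0 xM; pose S := range (fun F : {fset I} => \sum_(i <- F) x i).
have S0 : has_sup S.
  by split; [exists 0, fset0; rewrite ?big_seq_fset0|exists M => _ [F _ <-]].
exists (sup S); apply/cvgrPdist_lt => e e0.
have [_ [A _ <-] supA] := sup_adherent e0 S0; exists A => // B /= AB.
have sumAB : \sum_(i <- A) x i <= \sum_(i <- B) x i.
  by apply: ler_sum_subset => //; exact/fsubsetP.
have supB : \sum_(i <- B) x i <= sup S by apply: sup_upper_bound => //; exists B.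
rewrite partial_sumE ger0_norm ?subr_ge0// ltrBlDl -ltrBlDr.
exact: lt_le_trans supA sumAB.
Qed.

(** Write [x] as the difference of the nonnegative families [|x| + x] and [|x|], both with bounded
    partial sums. *)
Lemma has_sum_abs (x : I -> R) (M : R) :
  (forall F : {fset I}, \sum_(i <- F) `|x i| <= M) -> exists l, has_sum x l.
Proof.
move=> xM; have [l xl] := has_sum_nonneg (fun i => normr_ge0 (x i)) xM.
have [|F|m xm] := @has_sum_nonneg (fun i => `|x i| + x i) (M + M).
- by move=> i; have := ler_norm (- x i); rewrite normrN; lra.
- rewrite big_split /=; apply: lerD => //; apply: le_trans (xM F).
  by apply: ler_sum => i _; exact: ler_norm.
exists (m + (-1) *: l); have := has_sumD xm (has_sumZ (a := -1) xl).
by congr (has_sum _ _); apply/funext => i /=; rewrite scaleN1r; ring.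
Qed.

Lemma has_sum_realC (x : I -> R) l : has_sum x l ->
  has_sum (fun i => (x i)%:C%C : CC R) (l%:C)%C.
Proof.
move=> /cvgrPdist_lt xl; apply/cvg_normcP => e /xl; apply: filterS => A.
rewrite /summability.partial_sum -rmorph_sum -rmorphB.
by rewrite -(normc_real (_ - _)).
Qed.

Lemma normc_ge_Re_Im (z : CC R) : `|complex.Re z| <= normc z /\ `|complex.Im z| <= normc z.
Proof.
case: z => a b /=; rewrite -!sqrtr_sqr; split; apply: ler_wsqrtr.
  by rewrite lerDl sqr_ge0.
by rewrite lerDr sqr_ge0.
Qed.

Lemma has_sum_normc (x : I -> CC R) (M : R) :
  (forall F : {fset I}, \sum_(i <- F) normc (x i) <= M) ->
  exists2 l, has_sum x l & normc l <= M.
Proof.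
move=> xM.
have [|a xa] := @has_sum_abs (fun i => complex.Re (x i)) M.
  move=> F; apply: le_trans (xM F); apply: ler_sum => i _.
  by have [] := normc_ge_Re_Im (x i).
have [|b xb] := @has_sum_abs (fun i => complex.Im (x i)) M.
  move=> F; apply: le_trans (xM F); apply: ler_sum => i _.
  by have [] := normc_ge_Re_Im (x i).
have [l xl] : exists l, has_sum x l.
  eexists; have := has_sumD (has_sum_realC xa) (has_sumZ (a := 'i%C : R[i]) (has_sum_realC xb)).
  by congr (has_sum _ _); apply/funext => i /=; exact/esym/complexE.
(* If [normc l] exceeded [M], a partial sum closer to [l] than the excess would have modulus above
   [M]. *)
exists l => //; rewrite leNgt; apply/negP => lM.
have /cvg_normcP/(_ (normc l - M)) := xl; rewrite subr_gt0 => /(_ lM) [A _ lA].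
have {lA} : normc (l - summability.partial_sum x A) < normc l - M.
  exact: lA (fsubset_refl _).
rewrite partial_sumE => lA.
have := le_normcD (l - \sum_(i <- A) x i) (\sum_(i <- A) x i); rewrite subrK.
have := le_trans (le_normc_sum _ _ _) (xM A); lra.
Qed.

End AbsoluteSums.

(** * Absolute convergence of power series and Abel's lemma *)

Section PowerSeriesSums.
Context {R : realType} {N : nat}.
Implicit Types (c : power_series R N) (z w : 'rV[CC R]_N) (J : multi_index N).
Import Normc.

Lemma abs_conv_setP c z : abs_conv_set c z <->
  exists M : R, forall F : {fset multi_index N},
    \sum_(J <- F) normc (c J * monomial z J) <= M.
Proof.
rewrite /abs_conv_set /summable /=; split=> [cz|[M cM]].
  exists (fine (\esum_(J in setT) `|(normc (c J * monomial z J))%:E|%E)) => F.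
  rewrite -lee_fin fineK; last first.
    by rewrite ge0_fin_numE// esum_ge0.
  apply: esum_ge; exists [set` F]; first by split=> //; exact: finite_fset.
  rewrite -fsbig_seq//= -sumEFin; apply: lee_sum => J _.
  by rewrite lee_fin ler_norm.
apply: (@le_lt_trans _ _ M%:E); last exact: ltry.
apply: ge_ereal_sup => _ [X [Xfin _] <-].
rewrite fsbig_finite//= (eq_bigr (fun J => (normc (c J * monomial z J))%:E)).
  by rewrite sumEFin lee_fin.
by move=> J _; rewrite ger0_norm ?normc_ge0.
Qed.

Lemma ps_has_sum c z : abs_conv_set c z ->
  has_sum (fun J => c J * monomial z J : CC R) (ps_sum c z).
Proof.
by move=> /abs_conv_setP[M /has_sum_normc[l cl _]]; rewrite /ps_sum (has_sum_unique cl).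
Qed.

Lemma normc_monomial z J :
  normc (monomial z J) = \prod_(j < N) normc (z ord0 j) ^+ J j.
Proof. by rewrite normc_prod; apply: eq_bigr => j _; rewrite normcX. Qed.

Lemma geometric_partial_sum (q : R) m : 0 <= q < 1 ->
  \sum_(k < m) q ^+ k <= (1 - q)^-1.
Proof.
move=> /andP[q0 q1]; have q1' : 0 < 1 - q by rewrite subr_gt0.
rewrite -[leRHS]mul1r ler_pdivlMr// mulrC.
have := subrXX 1 q m; rewrite expr1n.
under eq_bigr do rewrite expr1n mul1r.
by move=> <-; rewrite lerBlDr lerDl exprn_ge0.
Qed.

(** The finite set [F] lies in a box of side [m], and the sum over the box factors into one-variable
    geometric sums. *)
Lemma multi_geometric_sum (q : 'I_N -> R) (F : {fset multi_index N}) :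
  (forall j, 0 <= q j < 1) ->
  \sum_(J <- F) \prod_(j < N) q j ^+ J j <= \prod_(j < N) (1 - q j)^-1.
Proof.
move=> q01; pose m := (\max_(J <- F) \max_(j < N) J j).+1.
have Jm J j : J \in F -> (J j < m)%N.
  move=> JF; rewrite ltnS; apply: leq_trans (leq_bigmax_seq _ JF isT).
  exact: (@leq_bigmax _ (fun j => J j)).
pose ext (f : {ffun 'I_N -> 'I_m}) : multi_index N := [ffun j => f j : nat].
have ext_inj : injective ext.
  by move=> f g /ffunP fg; apply/ffunP => j; apply/val_inj; have := fg j; rewrite !ffunE.
apply: (@le_trans _ _ (\sum_(J <- map ext (enum {: {ffun 'I_N -> 'I_m}}))
    \prod_(j < N) q j ^+ J j)).
  apply: ler_sum_subset => //.
  - by rewrite map_inj_uniq// enum_uniq.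
  - move=> J JF; apply/mapP; exists [ffun j => Ordinal (Jm J j JF)].
      by rewrite mem_enum.
    by apply/ffunP => j; rewrite !ffunE.
  - by move=> J; apply: prodr_ge0 => j _; rewrite exprn_ge0//; case/andP: (q01 j).
rewrite big_map big_enum /=.
under eq_bigr do under eq_bigr do rewrite ffunE.
rewrite -(bigA_distr_bigA (fun j (k : 'I_m) => q j ^+ k)).
apply: ler_prod => j _; rewrite geometric_partial_sum// andbT.
by apply: sumr_ge0 => k _; rewrite exprn_ge0//; case/andP: (q01 j).
Qed.

(** Abel's lemma: relative to the bounded terms at [w], the terms at [z] decay geometrically with
    ratios [|z_j| / |w_j| < 1]. The bound depends on the series only through [M], which later gives
    estimates uniform in a family of series. *)
Lemma abel_sum_le c z w M :
  (forall J, normc (c J * monomial w J) <= M) ->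
  (forall j, normc (z ord0 j) < normc (w ord0 j)) ->
  forall F : {fset multi_index N}, \sum_(J <- F) normc (c J * monomial z J) <=
    M * \prod_(j < N) (1 - normc (z ord0 j) / normc (w ord0 j))^-1.
Proof.
move=> cM zw F; pose q j := normc (z ord0 j) / normc (w ord0 j).
have w0 j : 0 < normc (w ord0 j) by apply: le_lt_trans (zw j); exact: normc_ge0.
have q01 j : 0 <= q j < 1.
  by rewrite divr_ge0 ?normc_ge0//= ltr_pdivrMr ?mul1r.
apply: (@le_trans _ _ (M * \sum_(J <- F) \prod_(j < N) q j ^+ J j)).
  rewrite mulr_sumr; apply: ler_sum => J _.
  have -> : normc (c J * monomial z J) =
      normc (c J * monomial w J) * \prod_(j < N) q j ^+ J j.
    rewrite !normcM !normc_monomial -mulrA -big_split /=; congr (_ * _).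
    by apply: eq_bigr => j _; rewrite -exprMn mulrC divfK// gt_eqF.
  apply: ler_wpM2r => //; apply: prodr_ge0 => j _.
  by rewrite exprn_ge0//; case/andP: (q01 j).
apply: ler_wpM2l; last exact: multi_geometric_sum.
by apply: le_trans (cM [ffun=> 0%N]); exact: normc_ge0.
Qed.

Lemma abs_conv_bounded c z : abs_conv_set c z ->
  exists M, forall J, normc (c J * monomial z J) <= M.
Proof.
by move=> /abs_conv_setP[M cM]; exists M => J; have := cM [fset J]%fset; rewrite big_seq_fset1.
Qed.

End PowerSeriesSums.

(** * Domains of convergence *)

Section Domains.
Context {R : realType} {N : nat}.
Implicit Types (c : power_series R N) (z w : 'rV[CC R]_N) (s : 'rV[R]_N).
Implicit Types (A D : set 'rV[CC R]_N).
Import Normc.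

Lemma ex_pos_lower_bound (f : 'I_N -> R) : (forall j, 0 < f j) ->
  exists2 e, 0 < e & forall j, e <= f j.
Proof.
move=> f0; exists (\big[Num.min/1]_j f j); first by apply: lt_bigmin => // j _.
by move=> j; exact: bigmin_le_cond.
Qed.

(** Move [x] radially outwards by [d]; at the origin any direction serves. *)
Lemma ex_normcD (x : CC R) (d : R) : 0 <= d ->
  exists2 y : CC R, normc (x - y) <= d & normc y = normc x + d.
Proof.
move=> d0; have [->|x0] := eqVneq x 0.
  by exists (d%:C)%C; rewrite ?sub0r ?normcN normc_real ger0_norm// normc0 add0r.
have nx : 0 < normc x by rewrite normc_gt0.
exists (x * ((1 + d / normc x)%:C)%C).
  have -> : x - x * ((1 + d / normc x)%:C)%C = x * ((- (d / normc x))%:C)%C.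
    by rewrite rmorphD rmorphN /= mulrDr mulr1 opprD addrA subrr sub0r mulrN.
  rewrite normcM normc_real normrN ger0_norm ?divr_ge0 ?normc_ge0//.
  by rewrite mulrC divfK// gt_eqF.
rewrite normcM normc_real ger0_norm ?addr_ge0 ?divr_ge0 ?normc_ge0//.
by rewrite mulrDr mulr1 mulrC divfK// gt_eqF.
Qed.

(** Every modulus is raised by half the radius of a ball inside the interior. Besides the room
    required by Abel's lemma, this yields a point without zero coordinates, where logarithms may be
    taken. *)
Lemma interior_enlarge A z : A° z ->
  exists2 w, A° w & forall j, normc (z ord0 j) < normc (w ord0 j).
Proof.
move=> /nbhs_interior /interior_normcP[e e0 zA].
have d0 : 0 < e / 2 by lra.
have /choice[y yP] : forall j, exists y : CC R,
    normc (z ord0 j - y) <= e / 2 /\ normc y = normc (z ord0 j) + e / 2.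
  by move=> j; have [y] := ex_normcD (z ord0 j) (ltW d0); exists y.
exists (\row_j y j); last by move=> j; rewrite mxE (yP j).2; lra.
by apply: zA => j; rewrite mxE; have := (yP j).1; lra.
Qed.

Lemma open_polydisc (r : 'rV[R]_N) : open (polydisc r).
Proof.
rewrite openE => z zr; apply/interior_normcP.
have [|e e0 er] := @ex_pos_lower_bound (fun j => r ord0 j - normc (z ord0 j)).
  by move=> j; rewrite subr_gt0.
exists e => // w zw j; have := le_normcD (w ord0 j - z ord0 j) (z ord0 j).
rewrite subrK; have := er j; have := zw j.
by rewrite -[normc (z _ _ - _)]normcN opprB; lra.
Qed.

Definition real_scale z (t : R) : 'rV[CC R]_N := \row_j ((t%:C)%C * z ord0 j).

Lemma continuous_real_scale z : continuous (real_scale z).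
Proof.
move=> t A /interior_normcP[e e0 tA].
pose B := 1 + \sum_j normc (z ord0 j).
have B0 : 0 < B by rewrite ltr_pwDl// sumr_ge0// => j _; exact: normc_ge0.
apply/nbhs_ballP; exists (e / B) => /=; first exact: divr_gt0.
move=> t' /= tt'; apply: tA => j; rewrite !mxE -mulrBl -rmorphB normcM normc_real.
apply: (@le_lt_trans _ _ (`|t - t'| * B)).
  apply: ler_wpM2l => //; rewrite /B (bigD1 j)//= addrCA lerDl addr_ge0// sumr_ge0// => k _.
  exact: normc_ge0.
by rewrite -ltr_pdivlMr.
Qed.

(** [D] is the union of the segments from the origin to its points, all of which share the
    origin. *)
Lemma connected_balanced D : D !=set0 ->
  (forall z w, D z -> (forall j, normc (w ord0 j) <= normc (z ord0 j)) -> D w) ->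
  connected D.
Proof.
move=> [z0 Dz0] Dbal.
have -> : D = \bigcup_(z in D) (real_scale z @` `[0, 1]).
  apply/seteqP; split=> [z Dz|w [z Dz] [t /= /[!in_itv]/= /andP[t0 t1] <-]].
    exists z => //; exists 1; first by rewrite /= in_itv /= ler01 lexx.
    by apply/rowP => j; rewrite mxE mul1r.
  apply: (Dbal z) => // j; rewrite mxE normcM normc_real ger0_norm//.
  by rewrite ler_piMl ?normc_ge0.
apply: bigcup_connected.
  exists 0 => z Dz; exists 0; first by rewrite /= in_itv /= ler01 lexx.
  by apply/rowP => j; rewrite !mxE mul0r.
move=> z Dz; apply: connected_continuous_connected; first exact: segment_connected.
by apply: continuous_subspaceT => t; exact: continuous_real_scale.
Qed.

Lemma polydisc_domain c w : (exists M, forall J, normc (c J * monomial w J) <= M) ->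
  forall z, (forall j, normc (z ord0 j) < normc (w ord0 j)) -> domain_of_convergence c z.
Proof.
move=> [M cM] z zw; pose r : 'rV[R]_N := \row_j normc (w ord0 j).
have zr : polydisc r z by move=> j; rewrite mxE.
have : (polydisc r)° z by rewrite (interior_id (polydisc r)).1//; exact: open_polydisc.
apply: interiorS => v vr; apply/abs_conv_setP; eexists; apply: abel_sum_le cM _ => j.
by have := vr j; rewrite mxE.
Qed.

Definition exp_map s : 'rV[CC R]_N := \row_j ((expR (s ord0 j))%:C)%C.

Lemma normc_exp_map s j : normc (exp_map s ord0 j) = expR (s ord0 j).
Proof. by rewrite mxE normc_real ger0_norm ?expR_ge0. Qed.

Lemma exp_map_neq0 s j : exp_map s ord0 j != 0.
Proof. by rewrite -normc_gt0 normc_exp_map expR_gt0. Qed.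

Lemma exp_mapK s : log_map (exp_map s) = s.
Proof. by apply/rowP => j; rewrite mxE normc_exp_map expRK. Qed.

Lemma log_mapK z j : z ord0 j != 0 -> expR (log_map z ord0 j) = normc (z ord0 j).
Proof. by move=> z0; rewrite mxE lnK// posrE normc_gt0. Qed.

Lemma complete_reinhardt_domain c : domain_of_convergence c !=set0 ->
  complete_reinhardt (domain_of_convergence c).
Proof.
have key z w : domain_of_convergence c z ->
    (forall j, normc (w ord0 j) <= normc (z ord0 j)) -> domain_of_convergence c w.
  move=> /interior_enlarge[v /interior_subset/abs_conv_bounded vc zv] wz.
  by apply: (polydisc_domain vc) => j; exact: le_lt_trans (zv j).
move=> c0; split; first by split=> //; [exact: open_interior|exact: connected_balanced].
exists [set r : 'rV[R]_N | (forall j, 0 < r ord0 j) /\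
  polydisc r `<=` domain_of_convergence c]; first by move=> r [].
apply/seteqP; split=> [z /interior_enlarge[v cv zv]|z [r [_ +]]]; last exact.
exists (\row_j normc (v ord0 j)); last by move=> j; rewrite mxE.
split=> [j|w wv]; first by rewrite mxE; apply: le_lt_trans (zv j); exact: normc_ge0.
by apply: key cv _ => j; have := wv j; rewrite mxE => /ltW.
Qed.

Section BoundedTerms.
Variables (c : power_series R N) (K : set 'rV[R]_N).
Hypothesis cK : forall w, (forall j, w ord0 j != 0) ->
  (exists M, forall J, normc (c J * monomial w J) <= M) <-> K (log_map w).

(** Forwards, enlarge [z] inside the domain, where terms are bounded; backwards, apply Abel's lemma
    at [exp_map s]. Comparing with exponentials instead of logarithms admits points [z] with zero
    coordinates. *)
Lemma domain_of_convergenceP z : domain_of_convergence c z <->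
  exists2 s, K s & forall j, normc (z ord0 j) < expR (s ord0 j).
Proof.
split=> [/interior_enlarge[v /interior_subset/abs_conv_bounded vc zv]|[s Ks zs]].
  have v0 j : v ord0 j != 0.
    by rewrite -normc_gt0; apply: le_lt_trans (zv j); exact: normc_ge0.
  exists (log_map v); first exact/cK.
  by move=> j; rewrite log_mapK.
apply: (@polydisc_domain _ (exp_map s)).
  by apply/cK; [exact: exp_map_neq0|rewrite exp_mapK].
by move=> j; rewrite normc_exp_map.
Qed.

Lemma log_image_domain : log_image (domain_of_convergence c) =
  [set s | exists2 s', K s' & forall j, s ord0 j < s' ord0 j].
Proof.
apply/seteqP; split=> [_ [z [cz z0] <-]|s [s' Ks' ss']].
  have /domain_of_convergenceP[s Ks zs] := cz; exists s => // j.
  by rewrite -ltr_expR log_mapK.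
exists (exp_map s); last exact: exp_mapK.
split; last exact: exp_map_neq0.
by apply/domain_of_convergenceP; exists s' => // j; rewrite normc_exp_map ltr_expR.
Qed.

End BoundedTerms.

End Domains.

(** * Series converging on a half-space *)

Section HalfSpaceSeries.
Context {R : realType} {N : nat}.
Implicit Types (z w : 'rV[CC R]_N) (s a b : 'rV[R]_N) (h k : R) (J : multi_index N).
Import Normc.

Definition simplex : set 'rV[R]_N :=
  [set a | (forall j, 0 <= a ord0 j) /\ \sum_(j < N) a ord0 j = 1].

Definition degree J : R := \sum_(j < N) (J j)%:R.

(* The Gaussian factor suppresses the indices J away from the ray spanned by a,
   so that only the growth in the direction a decides about convergence. *)
Definition half_space_coef a h J : R :=
  expR (- (h * degree J) - \sum_(j < N) ((J j)%:R - degree J * a ord0 j) ^+ 2).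

Lemma normc_monomial_log w J : (forall j, w ord0 j != 0) ->
  normc (monomial w J) = expR (\sum_(j < N) (J j)%:R * log_map w ord0 j).
Proof.
move=> w0; rewrite normc_monomial expR_sum; apply: eq_bigr => j _.
by rewrite expRM_natl log_mapK.
Qed.

(** Decomposing [J] as [degree J] times [a] plus a deviation splits the exponent: the first part
    tests on which side of the hyperplane [log_map w] lies, the second is a downward parabola in
    each deviation. *)
Lemma half_space_term a h w J : (forall j, w ord0 j != 0) ->
  half_space_coef a h J * normc (monomial w J) =
  expR (degree J * (dot a (log_map w) - h) +
    \sum_(j < N) (((J j)%:R - degree J * a ord0 j) * log_map w ord0 j
      - ((J j)%:R - degree J * a ord0 j) ^+ 2)).
Proof.
move=> w0; rewrite normc_monomial_log// -expRD; congr expR.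
rewrite sumrB mulrBr.
have -> : \sum_(j < N) ((J j)%:R - degree J * a ord0 j) * log_map w ord0 j =
    \sum_(j < N) (J j)%:R * log_map w ord0 j - degree J * dot a (log_map w).
  by rewrite /dot [degree J * _]mulr_sumr -sumrB; apply: eq_bigr => j _; rewrite mulrBl mulrA.
ring.
Qed.

(** The exponential of the maximum of the parabolas [x * s_j - x ^+ 2], summed over [j]. It involves
    neither the normal vector nor the offset, so it serves all half-spaces at once. *)
Definition half_space_bound s : R := expR (\sum_(j < N) s ord0 j ^+ 2 / 4).

Lemma half_space_coef_le a h w J : (forall j, w ord0 j != 0) ->
  dot a (log_map w) <= h ->
  half_space_coef a h J * normc (monomial w J) <= half_space_bound (log_map w).
Proof.
move=> w0 ah; rewrite half_space_term// ler_expR -[leRHS]add0r; apply: lerD.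
  by rewrite mulr_ge0_le0 ?subr_le0// sumr_ge0.
apply: ler_sum => j _; set x := _ - degree J * _; set y := log_map _ _ _.
have -> : x * y - x ^+ 2 = y ^+ 2 / 4 - (x - y / 2) ^+ 2 by field.
by rewrite lerBlDr lerDl sqr_ge0.
Qed.

(** Test the bound along the integer points nearest below the ray [m a]: their deviations from the
    ray stay bounded, while the linear part of the exponent grows like [m * d] when [log_map w] lies
    beyond the hyperplane. *)
Lemma half_space_coef_unbounded a h w M : simplex a -> (forall j, w ord0 j != 0) ->
  (forall J, half_space_coef a h J * normc (monomial w J) <= M) ->
  dot a (log_map w) <= h.
Proof.
move=> [a0 a1] w0 aM; rewrite leNgt; apply/negP; set s := log_map w => has.
pose d := dot a s - h; have d0 : 0 < d by rewrite subr_gt0.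
(* [C] bounds the loss from the deviations, each of which is shown below to be at most [N + 1] in
   absolute value. *)
pose C := \sum_(j < N) ((N%:R + 1) * `|s ord0 j| + (N%:R + 1) ^+ 2).
suff lowerb m : 1 + ((m%:R - N%:R) * d - C) <= M.
  have := lowerb (Num.truncn ((M + C + N%:R * d) / d)).+1.
  have := truncnS_gt ((M + C + N%:R * d) / d).
  by rewrite ltr_pdivrMr// ; lra.
pose J : multi_index N := [ffun j => Num.truncn (m%:R * a ord0 j)].
apply: le_trans (aM J); rewrite half_space_term//; apply: le_trans (expR_ge1Dx _).
(* [r j] is the fractional part lost by rounding; as [a] has sum 1, these parts add up to
   [m - degree J], which is between 0 and [N]. *)
rewrite lerD2l; pose r j := m%:R * a ord0 j - (J j)%:R.
have r01 j : 0 <= r j <= 1.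
  have /truncn_itv : 0 <= m%:R * a ord0 j by rewrite mulr_ge0.
  by rewrite /r ffunE -natr1 => /andP[]; lra.
have degE : degree J = m%:R - \sum_(j < N) r j.
  by rewrite /r sumrB -mulr_sumr a1 mulr1 /degree; ring.
have rho0 : 0 <= \sum_(j < N) r j by apply: sumr_ge0 => j _; case/andP: (r01 j).
have rhoN : \sum_(j < N) r j <= N%:R.
  rewrite -[leRHS](_ : \sum_(j < N) 1 = _); last by rewrite sumr_const card_ord.
  by apply: ler_sum => j _; case/andP: (r01 j).
apply: lerD; first by apply: ler_wpM2r; [exact: ltW|rewrite degE; lra].
rewrite /C -sumrN; apply: ler_sum => j _; set x := _ - degree J * _.
have aj1 : a ord0 j <= 1.
  by rewrite -a1 (bigD1 j)//= lerDl sumr_ge0.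
have xE : x = (\sum_(j < N) r j) * a ord0 j - r j.
  by rewrite /x degE; set S := \sum_(_ < _) _; rewrite /r; ring.
have ra0 : 0 <= (\sum_(j < N) r j) * a ord0 j by rewrite mulr_ge0.
have raN : (\sum_(j < N) r j) * a ord0 j <= N%:R.
  by apply: le_trans rhoN; rewrite ler_piMr.
have xN : `|x| <= N%:R + 1.
  by have := r01 j; rewrite ler_norml xE => /andP[]; have := ler0n R N; lra.
have xs : `|x * s ord0 j| <= (N%:R + 1) * `|s ord0 j| by rewrite normrM ler_wpM2r.
have x2 : x ^+ 2 <= (N%:R + 1) ^+ 2.
  by rewrite -(@real_normK _ x) ?num_real// lerXn2r// nnegrE addr_ge0.
have := ler_norm (- (x * s ord0 j)); rewrite normrN; lra.
Qed.

Lemma half_space_coef_ge0 a h J : 0 <= half_space_coef a h J.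
Proof. exact: expR_ge0. Qed.

(** * Combining two half-space series into a wedge series *)

Section Wedge.
Variables (c : power_series R N) (a b : 'rV[R]_N) (h k x y e : R).
Variables (p : multi_index N -> CC R) (J0 : multi_index N).
Hypotheses (sa : simplex a) (sb : simplex b) (x0 : 0 < x) (y0 : 0 < y).
Hypotheses (e1 : `|e| = 1) (pJ0 : forall J, J != J0 -> p J = 0).
Hypothesis cE : forall J, c J =
  p J + ((e * (x * half_space_coef a h J + y * half_space_coef b k J))%:C)%C.

(** Both half-space coefficients are nonnegative and carry the common sign [e], so a bound on their
    combination bounds each of them. The perturbation [p] lives at the single index [J0] and is
    therefore bounded at every point. *)
Lemma wedge_bounded w : (forall j, w ord0 j != 0) ->
  (exists M, forall J, normc (c J * monomial w J) <= M) <->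
  dot a (log_map w) <= h /\ dot b (log_map w) <= k.
Proof.
move=> w0.
pose u J := x * half_space_coef a h J + y * half_space_coef b k J.
have uE J : normc (((e * u J)%:C)%C * monomial w J) =
    x * (half_space_coef a h J * normc (monomial w J)) +
    y * (half_space_coef b k J * normc (monomial w J)).
  rewrite normcM normc_real normrM e1 mul1r ger0_norm /u; first by ring.
  by rewrite addr_ge0// mulr_ge0 ?half_space_coef_ge0// ltW.
have pM J : normc (p J * monomial w J) <= normc (p J0 * monomial w J0).
  have [->//|/pJ0 ->] := eqVneq J J0.
  by rewrite mul0r normc0 normc_ge0.
set P := normc (p J0 * _) in pM.
have term0 a' h' J : 0 <= half_space_coef a' h' J * normc (monomial w J).
  by rewrite mulr_ge0 ?half_space_coef_ge0 ?normc_ge0.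
split=> [[M cM]|[ha hb]].
  have uM J : normc (((e * u J)%:C)%C * monomial w J) <= M + P.
    have -> : ((e * u J)%:C)%C * monomial w J = c J * monomial w J - p J * monomial w J.
      by rewrite -mulrBl cE addrC addKr.
    by apply: le_trans (le_normcD _ _) _; rewrite normcN lerD.
  split.
    apply: (half_space_coef_unbounded (M := (M + P) / x)) => // J.
    rewrite ler_pdivlMr// mulrC; apply: le_trans (uM J); rewrite uE lerDl.
    by rewrite mulr_ge0 ?term0// ltW.
  apply: (half_space_coef_unbounded (M := (M + P) / y)) => // J.
  rewrite ler_pdivlMr// mulrC; apply: le_trans (uM J); rewrite uE lerDr.
  by rewrite mulr_ge0 ?term0// ltW.
exists (P + (x + y) * half_space_bound (log_map w)) => J.
rewrite cE mulrDl; apply: le_trans (le_normcD _ _) _; apply: lerD => //.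
by rewrite uE mulrDl lerD// ler_wpM2l ?half_space_coef_le// ltW.
Qed.

End Wedge.

Lemma simplex_dot_lt a s s' : simplex a -> (forall j, s ord0 j < s' ord0 j) ->
  dot a s < dot a s'.
Proof.
move=> [a0 a1] ss'.
have [j aj] : exists j, 0 < a ord0 j.
  apply: contrapT => /forallNP an.
  have : \sum_(j < N) a ord0 j = 0.
    by apply: big1 => j _; apply/eqP; rewrite eq_le a0 andbT leNgt; exact/negP/an.
  by rewrite a1 => /eqP; rewrite oner_eq0.
rewrite /dot (bigD1 j)//= [ltRHS](bigD1 j)//=; apply: ltr_leD.
  by rewrite ltr_pM2l.
by apply: ler_sum => i _; apply: ler_wpM2l => //; exact: ltW.
Qed.

Lemma simplex_dot_const a s (d : R) : simplex a ->
  dot a (s + const_mx d) = dot a s + d.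
Proof.
move=> [_ a1]; rewrite /dot; under eq_bigr do rewrite !mxE mulrDr.
by rewrite big_split -mulr_suml a1 mul1r.
Qed.

Lemma wedge_shift a b h k : simplex a -> simplex b ->
  [set s : 'rV[R]_N | exists2 s' : 'rV[R]_N,
    dot a s' <= h /\ dot b s' <= k & forall j, s ord0 j < s' ord0 j] =
  open_half_space a h `&` open_half_space b k.
Proof.
move=> sa sb; apply/seteqP; split=> [s [s' [as' bs'] ss']|s [as_ bs]].
  by split; [apply: lt_le_trans as'|apply: lt_le_trans bs']; exact: simplex_dot_lt.
rewrite /open_half_space /= in as_ bs.
(* Raising all coordinates by [d] raises both linear forms by exactly [d], since the entries of [a]
   and of [b] sum to 1. *)
pose d := Num.min (h - dot a s) (k - dot b s).
have d0 : 0 < d by rewrite lt_min !subr_gt0 as_.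
exists (s + const_mx d); last by move=> j; rewrite !mxE ltrDl.
by rewrite !simplex_dot_const// -!lerBrDl !ge_min !lexx orbT.
Qed.

Lemma dotD_conv a s s' (t u : R) : dot a (t *: s + u *: s') = t * dot a s + u * dot a s'.
Proof.
rewrite /dot !mulr_sumr -big_split /=; apply: eq_bigr => j _.
by rewrite !mxE; ring.
Qed.

End HalfSpaceSeries.

(** * Separation and support functions *)

Section ConvexGeometry.
Context {R : realType} {N : nat}.
Implicit Types (s x y u : 'rV[R]_N) (G A : set 'rV[R]_N).

Lemma dotC u x : dot u x = dot x u.
Proof. by apply: eq_bigr => j _; rewrite mulrC. Qed.

Lemma closure_rVP A x : closure A x <->
  forall e, 0 < e -> exists2 y, A y & forall j, `|x ord0 j - y ord0 j| < e.
Proof.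
split=> [clA e e0|Ax B /nbhs_ballP[e /= e0 xB]].
  have [|y [Ay [_ xy]]] := clA (ball x e); first exact: nbhsx_ballx.
  by exists y => // j; exact: xy.
have [y Ay xy] := Ax e e0; exists y; split=> //; apply: xB; split=> // i j.
by rewrite (ord1 i); exact: xy.
Qed.

(** The norm of row vectors is the sup norm; projecting onto a convex set needs the Euclidean
    distance. *)
Definition sqdist x y : R := \sum_(j < N) (x ord0 j - y ord0 j) ^+ 2.

Lemma continuous_sqdist y : continuous (sqdist ^~ y).
Proof.
apply: continuous_big => [|j _ x]; first exact: add_continuous.
have cj : {for x, continuous (fun x : 'rV[R]_N => x ord0 j - y ord0 j)}.
  apply: (@continuousB R R _ (fun x : 'rV[R]_N => x ord0 j) (fun=> y ord0 j)).
    exact: coord_continuous.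
  exact: cst_continuous.
apply: (@continuous_comp _ _ _ (fun x : 'rV[R]_N => x ord0 j - y ord0 j)
  (fun t : R => t ^+ 2) x cj).
exact: exprn_continuous.
Qed.

Lemma coord_sqdist x y j : `|x ord0 j - y ord0 j| ^+ 2 <= sqdist x y.
Proof.
rewrite real_normK ?num_real// /sqdist (bigD1 j)//= lerDl.
by apply: sumr_ge0 => k _; exact: sqr_ge0.
Qed.

Definition convex A := forall x y (t : R), A x -> A y -> 0 <= t <= 1 ->
  A (t *: x + (1 - t) *: y).

Lemma closest_point A s : A !=set0 -> exists2 p, closure A p &
  forall x, closure A x -> sqdist p s <= sqdist x s.
Proof.
(* Outside the box of half-width [M] around [s] the squared distance exceeds [M ^+ 2]. The summand 1
   ensures [M <= M ^+ 2], so such points are farther from [s] than [g], and minimising over the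
   compact box suffices. *)
move=> [g Ag]; pose M := 1 + sqdist g s.
have sq0 x : 0 <= sqdist x s by apply: sumr_ge0 => j _; exact: sqr_ge0.
have M1 : 1 <= M by rewrite lerDl.
have MM : M <= M ^+ 2 by rewrite expr2 ler_pMl//; lra.
pose B : set 'rV[R]_N :=
  [set x | forall j, `[s ord0 j - M, s ord0 j + M]%classic (x ord0 j)].
have BP x : B x <-> forall j, `|x ord0 j - s ord0 j| <= M.
  split=> Bx j; have := Bx j; rewrite /= in_itv /= ler_norml.
    by move=> /andP[? ?]; apply/andP; split; lra.
  by move=> /andP[? ?]; apply/andP; split; lra.
have cB : compact B.
  apply: (rV_compact (A := fun j => `[s ord0 j - M, s ord0 j + M]%classic)) => j.
  exact: segment_compact.
have cC : compact (closure A `&` B).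
  apply: (subclosed_compact _ cB) => //; apply: closedI; first exact: closed_closure.
  by apply: compact_closed cB; exact: (@norm_hausdorff R 'rV[R]_N).
have Cg : (closure A `&` B) g.
  split; first exact: subset_closure.
  apply/BP => j; rewrite -(@ler_pXn2r _ 2%N)// ?nnegrE//; last lra.
  by apply: le_trans (coord_sqdist _ _ _) _; apply: le_trans MM; rewrite lerDr.
have [|p /set_mem[Ap Bp] pmin] := compact_EVT_min (ex_intro _ g Cg) cC (f := sqdist ^~ s).
  by apply: continuous_subspaceT; exact: continuous_sqdist.
exists p => // x Ax; have [Bx|nBx] := pselect (B x); first by apply: pmin; exact/mem_set.
have pg : sqdist p s <= sqdist g s by apply: pmin; exact/mem_set.
apply: (le_trans pg); move: nBx => /BP/existsNP[j /negP]; rewrite -ltNge => Mj.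
apply: le_trans (coord_sqdist x s j); apply: (@le_trans _ _ M); first by rewrite lerDr.
apply: (le_trans MM); rewrite lerXn2r ?nnegrE ?(ltW Mj)//; lra.
Qed.

(** The hyperplane passes through the point [p] of the closure nearest to [s], with normal
    [s - p]. *)
Lemma separation A s : A !=set0 -> convex A -> ~ closure A s ->
  exists u c, (forall x, A x -> dot u x <= c) /\ c < dot u s.
Proof.
move=> A0 Aconv nAs; have [p Ap pmin] := closest_point s A0.
exists (s - p), (dot (s - p) p); split=> [x Ax|]; last first.
  have -> : dot (s - p) s = dot (s - p) p + sqdist s p.
    by rewrite /dot /sqdist -big_split /=; apply: eq_bigr => j _; rewrite !mxE; ring.
  rewrite ltrDl lt_neqAle sumr_ge0 ?andbT; last by move=> j _; exact: sqr_ge0.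
  apply/negP => /eqP/esym/eqP; rewrite psumr_eq0; last by move=> j _; exact: sqr_ge0.
  move=> /allP sp; apply: nAs; suff -> : s = p by [].
  apply/rowP => j; have := sp j; rewrite mem_index_enum sqrf_eq0 subr_eq0.
  by move=> /(_ isT)/eqP.
rewrite -subr_le0; set d := _ - _; pose q := sqdist x p.
have dE : d = \sum_(j < N) (s ord0 j - p ord0 j) * (x ord0 j - p ord0 j).
  by rewrite /d /dot -sumrB; apply: eq_bigr => j _; rewrite !mxE; ring.
(* Moving from [p] a fraction [t] towards [x] cannot come closer to [s]; expanding the square and
   dividing by [t] gives this. *)
have key t : 0 < t <= 1 -> 2 * d <= t * q.
  move=> /andP[t0 t1].
  have Ay : closure A (t *: x + (1 - t) *: p).
    apply/closure_rVP => e /((closure_rVP _ _).1 Ap)[p' Ap' pp'].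
    exists (t *: x + (1 - t) *: p'); first by apply: Aconv => //; rewrite t1 ltW.
    move=> j; rewrite !mxE.
    have -> : t * x ord0 j + (1 - t) * p ord0 j - (t * x ord0 j + (1 - t) * p' ord0 j) =
      (1 - t) * (p ord0 j - p' ord0 j) by ring.
    rewrite normrM; apply: le_lt_trans (pp' j).
    by rewrite ler_piMl// ger0_norm; lra.
  have := pmin _ Ay.
  have -> : sqdist (t *: x + (1 - t) *: p) s = sqdist p s - t * (2 * d) + t * (t * q).
    rewrite /q /sqdist dE !mulr_sumr -sumrB -big_split /=; apply: eq_bigr => j _.
    by rewrite !mxE; ring.
  by rewrite -addrA lerDl addrC subr_ge0 ler_pM2l.
have q0 : 0 <= q by apply: sumr_ge0 => j _; exact: sqr_ge0.
rewrite leNgt; apply/negP => d0.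
(* For this [t] the inequality would read [2 * (d + q) <= q], impossible when [d > 0]. *)
have := key (d / (d + q)); rewrite ler_pdivrMr ?mul1r ?divr_gt0 ?lerDl ?q0//=; try lra.
move=> /(_ isT); rewrite mulrAC -[leLHS]mulrC; apply/negP; rewrite -ltNge.
by rewrite ltr_pdivrMr; nra.
Qed.

(** Take rows from [P] of maximal rank: appending a further point of [P] cannot raise the rank, so
    the point is already in the row space. *)
Lemma ex_spanning_rows (P : set 'rV[R]_N) : exists m (V : 'M[R]_(m, N)),
  (forall i, P (row i V)) /\ forall p, P p -> (p <= V)%MS.
Proof.
pose Q r := `[< exists m (V : 'M[R]_(m, N)), (forall i, P (row i V)) /\ \rank V = r >].
have exQ : exists r, Q r.
  exists 0%N; apply/asboolP; exists 0%N, 0; split; first by case.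
  by rewrite mxrank0.
have Qle r : Q r -> (r <= N)%N.
  by move=> /asboolP[m [V [_ <-]]]; exact: rank_leq_col.
case: (ex_maxnP exQ Qle) => r /asboolP[m [V [PV rV]]] rmax.
exists m, V; split=> // p Pp.
have VVp : (V <= col_mx V p)%MS by rewrite -addsmxE addsmxSl.
have : Q (\rank (col_mx V p)).
  apply/asboolP; exists (m + 1)%N, (col_mx V p); split=> // i.
  case: (split_ordP i) => k ->; rewrite ?rowKu ?rowKd//.
  by rewrite (_ : row k p = p)//; apply/rowP => j; rewrite mxE (ord1 k).
move=> /rmax; rewrite -rV => rVp.
have := geq_leqif (mxrank_leqif_sup VVp); rewrite rVp => /esym VpV.
by apply: submx_trans VpV; rewrite -addsmxE addsmxSr.
Qed.

End ConvexGeometry.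

(** * Support functions of nonempty, downward closed sets *)

Section SupportFunction.
Context {R : realType} {N : nat}.
Implicit Types (s x y u : 'rV[R]_N).
Variable G : set 'rV[R]_N.
Hypothesis G0 : G !=set0.
Hypothesis Gdown : forall s s', G s -> (forall j, s' ord0 j <= s ord0 j) -> G s'.

Local Notation PS := (normalized_effective_domain G).
Local Notation h := (fun u => fine (support_function G u)).

Lemma support_function_ge u x : PS u -> G x -> dot u x <= h u.
Proof.
move=> [_ uh] Gx; rewrite -lee_fin fineK// dotC.
by apply: ereal_sup_ubound; exists x.
Qed.

Lemma support_function_le u B : (forall x, G x -> dot u x <= B) ->
  (support_function G u <= B%:E)%E.
Proof.
by move=> uB; apply: ge_ereal_sup => _ [x Gx <-]; rewrite lee_fin dotC uB.
Qed.

Lemma fine_support_function_le u B : PS u -> (forall x, G x -> dot u x <= B) -> h u <= B.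
Proof. by move=> [_ uh] /support_function_le; rewrite -lee_fin fineK. Qed.

(** A negative entry [u_j] would make the linear form unbounded on [G], which contains all points
    below [x] in direction [j]. The value [t] is chosen so that the form reaches [c + 1]. *)
Lemma bounded_above_ge0 u c : (forall x, G x -> dot u x <= c) -> forall j, 0 <= u ord0 j.
Proof.
move=> uc j; rewrite leNgt; apply/negP => uj; have [x Gx] := G0.
pose t := (c - dot u x + 1) / - u ord0 j.
have t0 : 0 <= t.
  by rewrite divr_ge0 ?oppr_ge0 ?(ltW uj)// addr_ge0// subr_ge0 uc.
have : dot u (x - t *: delta_mx ord0 j) <= c.
  by apply: uc; apply: (Gdown Gx) => k; rewrite !mxE lerBlDr lerDl mulr_ge0.
have -> : dot u (x - t *: delta_mx ord0 j) = dot u x - t * u ord0 j.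
  rewrite /dot (bigD1 j)//= [X in _ = X - _](bigD1 j)//=.
  rewrite (eq_bigr (fun k => u ord0 k * x ord0 k)).
    by rewrite !mxE !eqxx /=; ring.
  by move=> k kj; rewrite !mxE (negPf kj) andbF mulr0 subr0.
by rewrite -mulrN /t divfK ?oppr_eq0 ?lt_eqF//; lra.
Qed.

Lemma effective_domainP u :
  PS u <-> simplex u /\ exists B, forall x, G x -> dot u x <= B.
Proof.
split=> [uPS|[[u0 u1] [B uB]]].
  have u0 := bounded_above_ge0 (fun x => support_function_ge uPS (x := x)).
  split; last by exists (h u) => x; exact: support_function_ge.
  split=> //; case: uPS; rewrite /l1_sphere /= => <- _.
  by apply: eq_bigr => j _; rewrite ger0_norm.
split; first by rewrite /l1_sphere /= -u1; apply: eq_bigr => j _; rewrite ger0_norm.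
have [x Gx] := G0; rewrite fin_numElt; apply/andP; split.
  apply: (lt_le_trans (ltNyr (dot x u))).
  by apply: ereal_sup_ubound; exists x.
exact: le_lt_trans (support_function_le uB) (ltry _).
Qed.

Lemma supporting_half_spaceE u : PS u ->
  supporting_half_space G u = open_half_space u (h u).
Proof.
move=> [_ uh]; apply/funext => s; congr is_true.
by rewrite -[in LHS](fineK uh) -EFinB lte_fin subr_lt0.
Qed.

Lemma dot_linear (m : nat) u s (V : 'M[R]_(m, N)) (a : R) (c : 'I_m -> R) :
  dot (a *: u + \sum_i c i *: row i V) s = a * dot u s + \sum_i c i * dot (row i V) s.
Proof.
have dotD x y : dot (x + y) s = dot x s + dot y s.
  by rewrite /dot -big_split; apply: eq_bigr => j _; rewrite !mxE mulrDl.
have dotZ t x : dot (t *: x) s = t * dot x s.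
  by rewrite /dot mulr_sumr; apply: eq_bigr => j _; rewrite !mxE mulrA.
rewrite dotD dotZ; congr (_ + _).
elim/big_rec2: _ => [|i y x _ <-]; last by rewrite dotD dotZ.
by rewrite /dot big1// => j _; rewrite mxE mul0r.
Qed.

(* The support function need not be continuous on PS; the strict inequality at u
   is first spread to a relatively open subset of PS by moving from u slightly
   towards finitely many points of PS spanning the same subspace. *)
Lemma dense_support_lt (alpha : nat -> 'rV[R]_N) u s :
  range alpha `<=` PS -> PS `<=` closure (range alpha) ->
  PS u -> h u < dot u s -> exists n, h (alpha n) < dot (alpha n) s.
Proof.
move=> aPS adense uPS us.
have [m [V [VPS Vspan]]] := ex_spanning_rows PS.
pose M := \sum_i `|h (row i V) - dot (row i V) s|.
have M0 : 0 <= M by apply: sumr_ge0.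
pose d := dot u s - h u; have d0 : 0 < d by rewrite subr_gt0.
(* With this [t] the weight [1 - t * m] is nonnegative, and the gap [(1 - t * m) * d - 2 * t * M]
   that remains for weights up to [2 * t] is positive. *)
pose t := d / (2 * (m%:R * d + 2 * M + d)).
have den0 : 0 < m%:R * d + 2 * M + d.
  by rewrite ltr_wpDl// addr_ge0 ?mulr_ge0// ltW.
have t0 : 0 < t by rewrite divr_gt0// mulr_gt0.
have tE : t * (m%:R * d + 2 * M + d) = d / 2 by rewrite /t; field; rewrite gt_eqF.
have tm0 : 0 <= t * m%:R by apply: mulr_ge0 => //; exact: ltW.
have tM0 : 0 <= t * M by apply: mulr_ge0 => //; exact: ltW.
have tmd : t * m%:R * d <= 1 * d by have := mulr_gt0 t0 d0; lra.
have tm1 : t * m%:R <= 1 by rewrite -(ler_pM2r d0).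
pose comb (c : 'I_m -> R) := (1 - t * m%:R) *: u + \sum_i c i *: row i V.
have comb_le c : (forall i, 0 <= c i) -> forall x, G x ->
    dot (comb c) x <= (1 - t * m%:R) * h u + \sum_i c i * h (row i V).
  move=> c0 x Gx; rewrite dot_linear; apply: lerD.
    by apply: ler_wpM2l; [lra|exact: support_function_ge].
  by apply: ler_sum => i _; apply: ler_wpM2l => //; exact: support_function_ge.
have comb_lt c : (forall i, 0 <= c i <= 2 * t) -> PS (comb c) -> h (comb c) < dot (comb c) s.
  move=> ct cPS; have c0 i : 0 <= c i by case/andP: (ct i).
  apply: le_lt_trans (fine_support_function_le cPS (comb_le c c0)) _.
  rewrite dot_linear -subr_gt0.
  have : \sum_i c i * h (row i V) - \sum_i c i * dot (row i V) s <= 2 * t * M.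
    rewrite -sumrB mulr_sumr; apply: ler_sum => i _; rewrite -mulrBr.
    have /andP[_ ci] := ct i.
    by apply: le_trans (ler_wpM2l (c0 i) (ler_norm _)) _; exact: ler_wpM2r.
  have := mulr_gt0 t0 d0; have -> : dot u s = h u + d by rewrite /d; ring.
  lra.
(* All weights of [b] sit in the middle of [[0, 2 * t]], so small moves within the span of [PS] keep
   them admissible. *)
pose b := comb (fun=> t).
have simplexV i : simplex (row i V) by case/effective_domainP: (VPS i).
have bPS : PS b.
  apply/effective_domainP; split; last by eexists; apply: comb_le => i; exact: ltW.
  have /effective_domainP[[u0 u1] _] := uPS; split=> [j|].
    rewrite !mxE summxE addr_ge0 ?mulr_ge0 ?subr_ge0//; apply: sumr_ge0 => i _.
    by rewrite mxE mulr_ge0 ?(ltW t0)//; case: (simplexV i).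
  have dot1 x : dot x (const_mx 1) = \sum_(j < N) x ord0 j.
    by rewrite /dot; apply: eq_bigr => j _; rewrite [const_mx _ _ _]mxE mulr1.
  rewrite -dot1 dot_linear dot1 u1; under eq_bigr do rewrite dot1 (simplexV _).2.
  by rewrite sumr_const card_ord -mulr_natr; ring.
(* [Q] controls the pseudo-inverse of [V]: a displacement with entries below [t / (1 + Q)] has
   coefficients of size at most [t] on the rows of [V]. *)
pose Q := \sum_(k < N) \sum_i `|pinvmx V k i|.
have Q0 : 0 <= Q by apply: sumr_ge0 => k _; exact: sumr_ge0.
have [|_ [n _ <-] bn] := (closure_rVP _ _).1 (adense _ bPS) (t / (1 + Q)).
  by rewrite divr_gt0// ltr_pwDl.
exists n; have anPS : PS (alpha n) by apply: aPS; exists n.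
pose q := (alpha n - b) *m pinvmx V.
have qV : q *m V = alpha n - b.
  rewrite mulmxKpV// -[alpha n - b]/(alpha n + - b) addmx_sub//; first exact: Vspan.
  by rewrite -scaleN1r scalemx_sub// Vspan.
have qt i : `|q ord0 i| <= t.
  rewrite mxE; apply: (le_trans (ler_norm_sum _ _ _)).
  apply: (@le_trans _ _ (t / (1 + Q) * Q)).
    rewrite mulr_sumr; apply: ler_sum => k _; rewrite normrM ler_pM//.
      by have := bn k; rewrite !mxE distrC => /ltW.
    by rewrite (bigD1 i)//= lerDl sumr_ge0.
  by rewrite mulrAC ler_pdivrMr ?ltr_pwDl// ler_pM2l// lerDr.
have aE : alpha n = comb (fun i => t + q ord0 i).
  rewrite /comb; under eq_bigr do rewrite scalerDl.
  by rewrite big_split /= -mulmx_sum_row qV addrA -/(comb (fun=> t)) -/b addrC subrK.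
rewrite aE; apply: comb_lt; last by rewrite -aE.
by move=> i; have := qt i; rewrite ler_norml => /andP[? ?]; apply/andP; split; lra.
Qed.

Hypothesis Gconvex : convex G.

(** If [s'] is in the closure of [G], a point of [G] close to [s'] dominates [s]. Otherwise a
    separating normal, rescaled into [PS], is violated by [s'], and by density so is some
    [alpha n]. *)
Lemma mem_support_shift (alpha : nat -> 'rV[R]_N) s s' :
  range alpha `<=` PS -> PS `<=` closure (range alpha) ->
  (forall n, dot (alpha n) s' <= h (alpha n)) ->
  (forall j, s ord0 j < s' ord0 j) -> G s.
Proof.
move=> aPS adense as' ss'.
have [|e e0 es] := @ex_pos_lower_bound R N (fun j => s' ord0 j - s ord0 j).
  by move=> j; rewrite subr_gt0.
have [/closure_rVP/(_ e e0)[y Gy s'y]|/(separation G0 Gconvex)[u [c [uc cs']]]] :=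
    pselect (closure G s').
  apply: (Gdown Gy) => j; have := s'y j; have := es j.
  by rewrite ltr_norml => ? /andP[_]; lra.
have u0 := bounded_above_ge0 uc.
(* The normal [u] has nonnegative entries and cannot be zero, as the zero form separates nothing;
   dividing by [S] puts it on the simplex. *)
pose S := \sum_(j < N) u ord0 j.
have S0 : 0 < S.
  rewrite lt_neqAle sumr_ge0// andbT eq_sym; apply/negP.
  rewrite psumr_eq0// => /allP uz; have [x Gx] := G0.
  have dot0 y : dot u y = 0.
    by rewrite /dot big1// => j _; rewrite (eqP (uz j (mem_index_enum j))) mul0r.
  by have := uc x Gx; move: cs'; rewrite !dot0; lra.
have dotS y : dot (S^-1 *: u) y = dot u y / S.
  by rewrite mulrC /dot mulr_sumr; apply: eq_bigr => j _; rewrite mxE mulrA.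
have uPS : PS (S^-1 *: u).
  apply/effective_domainP; split; last first.
    by exists (c / S) => x Gx; rewrite dotS ler_pM2r ?invr_gt0 ?uc.
  split=> [j|]; first by rewrite mxE mulr_ge0// invr_ge0 ltW.
  by under eq_bigr do rewrite mxE; rewrite -mulr_sumr mulVf// gt_eqF.
have [|n] := @dense_support_lt alpha (S^-1 *: u) s' aPS adense uPS.
  apply: (@le_lt_trans _ _ (c / S)).
    by apply: fine_support_function_le => // x Gx; rewrite dotS ler_pM2r ?invr_gt0 ?uc.
  by rewrite dotS ltr_pM2r ?invr_gt0.
by rewrite ltNge as'.
Qed.

End SupportFunction.

(** * The decomposition *)

Section ReinhardtLogImage.
Context {R : realType} {N : nat}.
Implicit Types (z w : 'rV[CC R]_N) (s : 'rV[R]_N).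
Import Normc.

Lemma convex_setP (A : set 'rV[R]_N) :
  convex_set (A : set (convex_lmodType 'rV[R]_N)) <-> convex A.
Proof.
split=> [Aconv x y t Ax Ay /andP[t0 t1]|Aconv x y t /set_mem Ax /set_mem Ay].
  have := Aconv x y (Itv01 t0 t1) (mem_set Ax) (mem_set Ay).
  by move=> /set_mem.
apply/mem_set; apply: Aconv => //; exact/andP.
Qed.

Variable D : set 'rV[CC R]_N.
Hypothesis DR : complete_reinhardt D.

Lemma reinhardt_down z w : D z ->
  (forall j, normc (w ord0 j) <= normc (z ord0 j)) -> D w.
Proof.
have [_ [P _ ->]] := DR => -[r Pr zr] wz; exists r => // j.
exact: le_lt_trans (wz j) (zr j).
Qed.

Lemma reinhardt_enlarge z : D z ->
  exists2 w, D w & forall j, normc (z ord0 j) < normc (w ord0 j).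
Proof.
have [[_ oD _] _] := DR => Dz.
have /interior_enlarge[w /interior_subset Dw zw] : D° z by rewrite (interior_id D).1.
by exists w.
Qed.

Lemma log_imageP s : log_image D s <-> D (exp_map s).
Proof.
split=> [[z [Dz z0] <-]|Ds]; last first.
  by exists (exp_map s); [split=> // j; exact: exp_map_neq0|exact: exp_mapK].
by apply: (reinhardt_down Dz) => j; rewrite normc_exp_map log_mapK.
Qed.

Lemma log_image_nonempty : log_image D !=set0.
Proof.
have [[[z Dz] _ _] _] := DR; have [w Dw zw] := reinhardt_enlarge Dz.
exists (log_map w), w => //; split=> // j.
by rewrite -normc_gt0; apply: le_lt_trans (zw j); exact: normc_ge0.
Qed.

Lemma log_image_down s s' : log_image D s ->
  (forall j, s' ord0 j <= s ord0 j) -> log_image D s'.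
Proof.
move=> /log_imageP Ds s's; apply/log_imageP; apply: (reinhardt_down Ds) => j.
by rewrite !normc_exp_map ler_expR.
Qed.

End ReinhardtLogImage.

Lemma convexI_half_space {R : realType} {N : nat} (a b : 'rV[R]_N) (h k : R) :
  convex (open_half_space a h `&` open_half_space b k).
Proof.
have key (c : 'rV[R]_N) l : convex (open_half_space c l).
  move=> x y t; rewrite /open_half_space /= dotD_conv => cx cy /andP[t0 t1].
  have [->|t0'] := eqVneq t 0; first by rewrite mul0r add0r subr0 mul1r.
  have {}t0 : 0 < t by rewrite lt_neqAle eq_sym t0'.
  have : t * dot c x < t * l by rewrite ltr_pM2l.
  have : (1 - t) * dot c y <= (1 - t) * l by rewrite ler_wpM2l ?subr_ge0// ltW.
  lra.
by move=> x y t [ax bx] [ay by_] t01; split; exact: key.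
Qed.

Section ConstantTerm.
Context {R : realType} {N : nat}.
Variable g : power_series R N.
Implicit Type w : 'rV[CC R]_N.
Import Normc.

Lemma constant_term_bounded w :
  exists M, forall J, normc (constant_term g J * monomial w J) <= M.
Proof.
exists (normc (g [ffun=> 0%N])) => J; rewrite /constant_term; case: eqVneq => [->|_].
  by rewrite /monomial big1 ?mulr1// => j _; rewrite ffunE expr0.
by rewrite mul0r normc0 normc_ge0.
Qed.

Lemma domain_constant_term : domain_of_convergence (constant_term g) = setT.
Proof.
apply/seteqP; split=> // z _.
apply/(@domain_of_convergenceP _ _ _ setT).
  by move=> w _; split=> // _; exact: constant_term_bounded.
exists (\row_j normc (z ord0 j)) => // j; rewrite mxE.
by apply: lt_le_trans (expR_ge1Dx _); rewrite ltrDr.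
Qed.

Lemma log_image_setT : log_image (@setT 'rV[CC R]_N) = setT.
Proof.
apply/seteqP; split=> // s _; exists (exp_map s); last exact: exp_mapK.
by split=> // j; exact: exp_map_neq0.
Qed.

Lemma simple_constant_term : simple_power_series (constant_term g).
Proof.
have dT := domain_constant_term.
split; first by apply: complete_reinhardt_domain; exists 0; rewrite dT.
  by rewrite /log_convex dT log_image_setT; apply/convex_setP.
(* The empty family of half-spaces has the whole space as its intersection. *)
exists 0%N, (fun=> setT); split=> [i|]; first by left.
by rewrite dT log_image_setT bigcapT.
Qed.

End ConstantTerm.

(** * The wedge series and their domains of convergence *)

Section Construction.
Context {R : realType} {N : nat}.
Implicit Types z w : 'rV[CC R]_N.
Variables (D : set 'rV[CC R]_N) (alpha : nat -> 'rV[R]_N) (g : power_series R N).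
Hypotheses (DR : complete_reinhardt D) (Dconv : log_convex D).
Local Notation G := (log_image D).
Hypotheses (aPS : range alpha `<=` normalized_effective_domain G).
Hypotheses (adense : normalized_effective_domain G `<=` closure (range alpha)).
Hypothesis gD : domain_of_convergence g = D.
Import Normc.

Definition support_value (n : nat) : R := fine (support_function G (alpha n)).
Local Notation h := support_value.

(* The signs alternate so that no cancellation can occur in a difference of two
   consecutive terms. *)
Definition half_space_series (n : nat) : power_series R N :=
  fun J => (((- 2^-1) ^+ n * half_space_coef (alpha n) (h n) J)%:C)%C.
Local Notation v := half_space_series.

(** The constant term is reserved for [sigma 0]; adding [v 0] offsets the [- v 0] left over by the
    telescoping differences. *)
Definition corrected_series : power_series R N :=
  fun J => g J - constant_term g J + v 0 J.

Definition single_term (n : nat) : power_series R N :=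
  fun J => if choice.pickle J == n then corrected_series J else 0.

Definition wedge_series (n : nat) : power_series R N :=
  if n is n'.+1 then fun J => single_term n' J + (v n'.+1 J - v n' J)
  else constant_term g.
Local Notation sigma := wedge_series.

Let PS n : normalized_effective_domain G (alpha n).
Proof. by apply: aPS; exists n. Qed.

Let simplexa n : simplex (alpha n).
Proof.
have /effective_domainP := PS n.
by move=> /(_ (log_image_nonempty DR) (log_image_down DR))[].
Qed.

(** In [v n.+1 - v n] both coefficients have the sign of [(-1) ^+ n.+1], so [wedge_bounded]
    applies. *)
Lemma wedge_series_bounded n w : (forall j, w ord0 j != 0) ->
  (exists M, forall J, normc (sigma n.+1 J * monomial w J) <= M) <->
  dot (alpha n.+1) (log_map w) <= h n.+1 /\ dot (alpha n) (log_map w) <= h n.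
Proof.
(* When [n] is not the code of a multi-index, [single_term n] vanishes identically and the default
   index is harmless. *)
pose J0 : multi_index N := odflt [ffun=> 0%N] (pickle_inv n).
apply: (@wedge_bounded _ _ _ _ _ _ _ (2^-1 ^+ n.+1) (2^-1 ^+ n) ((-1) ^+ n.+1)
  (single_term n) J0).
- exact: simplexa.
- exact: simplexa.
- by rewrite exprn_gt0.
- by rewrite exprn_gt0.
- by rewrite normrX normrN1 expr1n.
- move=> J JJ0; rewrite /single_term; case: eqP => // Jn.
  by case/eqP: JJ0; rewrite /J0 -Jn pickleK_inv.
- move=> J; rewrite /wedge_series /half_space_series -rmorphB; congr (_ + (_%:C)%C).
  rewrite !(exprNn 2^-1) mulrDr !mulrA; congr (_ + _).
  by rewrite exprS mulN1r !mulNr.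
Qed.

Lemma log_image_wedge n : log_image (domain_of_convergence (sigma n.+1)) =
  open_half_space (alpha n.+1) (h n.+1) `&` open_half_space (alpha n) (h n).
Proof.
pose K : set 'rV[R]_N :=
  [set s | dot (alpha n.+1) s <= h n.+1 /\ dot (alpha n) s <= h n].
rewrite (@log_image_domain _ _ _ K (wedge_series_bounded n)).
exact: wedge_shift.
Qed.

Lemma sub_domain n : D `<=` domain_of_convergence (sigma n).
Proof.
case: n => [|n]; first by rewrite domain_constant_term.
move=> z /(reinhardt_enlarge DR)[w Dw zw].
have w0 j : w ord0 j != 0.
  by rewrite -normc_gt0; apply: le_lt_trans (zw j); exact: normc_ge0.
apply: (polydisc_domain _ zw); apply/wedge_series_bounded => //.
have Gw : G (log_map w) by exists w.
by split; apply: support_function_ge.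
Qed.

Lemma bigcap_domain : (\bigcap_n domain_of_convergence (sigma n))° = D.
Proof.
apply/seteqP; split=> [z|]; last first.
  have [[_ oD _] _] := DR; rewrite -{1}((interior_id D).1 oD).
  by apply: interiorS => z Dz n _; exact: sub_domain.
(* Two enlargements: [w'] satisfies all the wedge inequalities, and the strict step from [w] to [w']
   absorbs the passage to the closure of [G]. *)
move=> /interior_enlarge[w /interior_enlarge[w' /interior_subset capw' ww'] zw].
have w0 j : w ord0 j != 0.
  by rewrite -normc_gt0; apply: le_lt_trans (zw j); exact: normc_ge0.
have w'0 j : w' ord0 j != 0.
  by rewrite -normc_gt0; apply: le_lt_trans (ww' j); exact: normc_ge0.
suff /log_imageP Dw : G (log_map w).
  apply: (reinhardt_down DR (Dw DR)) => j; rewrite normc_exp_map log_mapK//.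
  exact: ltW.
have Gconv : convex G by exact/convex_setP.
apply: (mem_support_shift (log_image_nonempty DR) (log_image_down DR) Gconv
  (alpha := alpha) (s' := log_map w')) => // [n|j]; last first.
  by rewrite -ltr_expR !log_mapK.
suff [_] : (open_half_space (alpha n.+1) (h n.+1) `&` open_half_space (alpha n) (h n))
   (log_map w') by move=> /ltW.
by rewrite -log_image_wedge; exists w' => //; split=> //; exact: capw'.
Qed.

Lemma alpha_neq0 n : alpha n != 0.
Proof.
apply/eqP => an; have [_] := simplexa n; rewrite an.
by under eq_bigr do rewrite mxE; rewrite big1// => /eqP; rewrite eq_sym oner_eq0.
Qed.

Lemma simple_wedge_series n : simple_power_series (sigma n).
Proof.
case: n => [|n]; first exact: simple_constant_term.
split.
- apply: complete_reinhardt_domain; have [[[z Dz] _ _] _] := DR.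
  by exists z; exact: sub_domain.
- apply/convex_setP; rewrite log_image_wedge; exact: convexI_half_space.
- exists 2, (fun i => if i == ord0 then open_half_space (alpha n.+1) (h n.+1)
                 else open_half_space (alpha n) (h n)).
  split=> [i|].
    by right; case: ifP => _; [exists (alpha n.+1), (h n.+1)|exists (alpha n), (h n)];
       split=> //; exact: alpha_neq0.
  rewrite log_image_wedge; apply/seteqP; split=> [s [s1 s2] i _|s cs]; first by case: ifP.
  by split; [have := cs ord0 I|have := cs ord_max I].
Qed.

Section Sum.
Variable z : 'rV[CC R]_N.
Hypothesis Dz : D z.
Local Notation at_z c := (fun J => c J * monomial z J : CC R).

(** [C] is independent of [n]: one point [w] of [D] beyond [z] serves for all [n], and the bound on
    the terms at [w] depends only on [w] apart from the factor [2^-1 ^+ n]. *)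
Lemma half_space_series_sum : exists C : R, forall n,
  exists2 l, has_sum (at_z (v n)) l & normc l <= 2^-1 ^+ n * C.
Proof.
have [w Dw zw] := reinhardt_enlarge DR Dz.
have w0 j : w ord0 j != 0.
  by rewrite -normc_gt0; apply: le_lt_trans (zw j); exact: normc_ge0.
exists (half_space_bound (log_map w) *
  \prod_(j < N) (1 - normc (z ord0 j) / normc (w ord0 j))^-1) => n.
apply: has_sum_normc => F; rewrite mulrA; apply: abel_sum_le zw F => J.
rewrite normcM normc_real normrM (ger0_norm (half_space_coef_ge0 _ _ _)).
rewrite normrX normrN (@ger0_norm _ 2^-1) ?invr_ge0// -mulrA ler_wpM2l ?exprn_ge0 ?invr_ge0//.
by apply: half_space_coef_le => //; apply: support_function_ge => //; exists w.
Qed.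

Definition initial_indices (n : nat) : {fset multi_index N} :=
  [fset J in pmap pickle_inv (iota 0 n)]%fset.

Lemma in_initial_indices n J : (J \in initial_indices n) = (choice.pickle J < n)%N.
Proof.
rewrite /initial_indices in_fset /= mem_pmap; apply/mapP/idP => [[k]|Jn].
  rewrite mem_iota /= => kn Jk; rewrite (leq_trans _ kn)//.
  by have := @pickle_invK (multi_index N) k; rewrite -Jk /= => <-.
by exists (choice.pickle J); rewrite ?mem_iota// pickleK_inv.
Qed.

Lemma wedge_series_sum :
  series (fun n => ps_sum (sigma n) z) @ \oo --> ps_sum g z.
Proof.
have [C vC] := half_space_series_sum.
have /choice[S vS] : forall n, exists l : CC R,
    has_sum (at_z (v n)) l /\ normc l <= 2^-1 ^+ n * C.
  by move=> n; have [l] := vC n; exists l.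
have gz : has_sum (at_z g) (ps_sum g z).
  by apply: ps_has_sum; apply: interior_subset; move: Dz; rewrite -gD.
have [c0 c0z] : exists l, has_sum (at_z (constant_term g)) l.
  eexists; apply: (has_sum_finite (F := [fset [ffun=> 0%N]]%fset)) => J.
  by rewrite inE /constant_term => /negPf ->; rewrite mul0r.
pose x := at_z corrected_series.
have xz : has_sum x (ps_sum g z - c0 + S 0%N).
  have := has_sumD (has_sumD gz (has_sumZ (a := -1) c0z)) (vS 0%N).1.
  rewrite scaleN1r; congr (has_sum _ _); apply/funext => J /=.
  by rewrite scaleN1r /x /corrected_series !mulrDl mulNr.
pose q n := \sum_(J <- initial_indices n.+1) single_term n J * monomial z J.
have qz n : has_sum (at_z (single_term n)) (q n).
  apply: has_sum_finite => J; rewrite in_initial_indices /single_term.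
  by case: eqP => [->|_ _]; [rewrite ltnSn|rewrite mul0r].
have q_sum n : \sum_(k < n) q k = \sum_(J <- initial_indices n) x J.
  (* The sum of the first [m] single-term series is the truncation of [x] to codes below [m]; both
     sides are compared as unordered sums of [r]. *)
  pose r m J := if (choice.pickle J < m)%N then x J else 0.
  have rz m : has_sum (r m) (\sum_(k < m) q k).
    elim: m => [|m IH].
      by rewrite big_ord0 -(big_seq_fset0 +%R (r 0%N)); exact: has_sum_finite.
    rewrite big_ord_recr /=; have := has_sumD IH (qz m).
    congr (has_sum _ _); apply/funext => J /=; rewrite /r /single_term ltnS.
    rewrite (leq_eqVlt (choice.pickle J)).
    by case: ltngtP => _; rewrite ?mul0r ?addr0 ?add0r.
  rewrite -(has_sum_unique (rz n)).
  have /has_sum_unique -> : has_sum (r n) (\sum_(J <- initial_indices n) r n J).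
    by apply: has_sum_finite => J; rewrite in_initial_indices /r => /negPf ->.
  rewrite big_seq [RHS]big_seq; apply: eq_bigr => J.
  by rewrite in_initial_indices /r => ->.
have sigma0 : ps_sum (sigma 0%N) z = c0 by exact: (has_sum_unique c0z).
have sigmaS n : ps_sum (sigma n.+1) z = q n + (S n.+1 - S n).
  apply: has_sum_unique.
  have := has_sumD (qz n) (has_sumD (vS n.+1).1 (has_sumZ (a := -1) (vS n).1)).
  rewrite scaleN1r; congr (has_sum _ _); apply/funext => J /=.
  by rewrite scaleN1r !mulrDl mulNr.
rewrite -cvg_shiftS.
(* The shift by one splits off [sigma 0]; the other [n] series give the first [n] terms of [x] and
   the telescoped [S n - S 0]. *)
have -> : (fun n => series (fun n => ps_sum (sigma n) z) n.+1) =
    (fun n => \sum_(J <- initial_indices n) x J + S n + (c0 - S 0%N)).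
  apply/funext => n; rewrite /series /= big_nat_recl// sigma0.
  rewrite big_mkord -q_sum; under eq_bigr do rewrite sigmaS.
  rewrite big_split /= -(big_mkord xpredT (fun k => S k.+1 - S k)) telescope_sumr//.
  ring.
have -> : ps_sum g z = (ps_sum g z - c0 + S 0%N) + 0 + (c0 - S 0%N) by ring.
apply: cvgD; last exact: cvg_cst.
apply: cvgD.
  apply: (has_sum_exhaust xz) => [m n mn|J].
    apply/fsubsetP => J; rewrite !in_initial_indices => /leq_trans; exact.
  by exists (choice.pickle J).+1; rewrite in_initial_indices.
apply/cvg_normcP => e e0.
have : geometric C 2^-1 @ \oo --> (0 : R).
  by apply: cvg_geometric; rewrite ger0_norm ?invr_ge0// invf_lt1// ltr1n.
move=> /cvgrPdist_lt/(_ e e0); apply: filterS => n; rewrite !sub0r !normrN normcN.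
by apply: le_lt_trans; apply: le_trans (vS n).2 _; rewrite mulrC ler_norm.
Qed.

End Sum.

End Construction.

Theorem theorem1p4 (R : realType) (N : nat) (D : set 'rV[CC R]_N)
    (D_reinhardt : complete_reinhardt D) (D_convex : log_convex D)
    (D_proper : D <> setT)
    (alpha : nat -> 'rV[R]_N) (alpha_inj : injective alpha)
    (alpha_PSh : range alpha `<=` normalized_effective_domain (log_image D))
    (alpha_dense :
       normalized_effective_domain (log_image D) `<=` closure (range alpha))
    (g : power_series R N) (g_dom : domain_of_convergence g = D) :
  exists sigma : nat -> power_series R N,
    [/\ (forall n, simple_power_series (sigma n)) /\
          sigma 0%N = constant_term g,
        forall n, wedge_with_normals (alpha n.+1) (alpha n)
                    (log_image (domain_of_convergence (sigma n.+1))),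
        (forall n, log_image (domain_of_convergence (sigma n.+1)) =
           supporting_half_space (log_image D) (alpha n.+1) `&`
           supporting_half_space (log_image D) (alpha n)) /\
          domain_bigcap (fun n => domain_of_convergence (sigma n)) = D,
        largest_open (fun U => forall n, U `<=` abs_conv_set (sigma n)) D &
        forall z, D z ->
          series (fun n => ps_sum (sigma n) z) @ \oo --> ps_sum g z].
Proof.
exists (wedge_series D alpha g).
have capD := bigcap_domain g D_reinhardt D_convex alpha_PSh alpha_dense.
have logW := log_image_wedge g D_reinhardt alpha_PSh.
split.
- by split=> // n; exact: simple_wedge_series.
- move=> n; split; try exact: (alpha_neq0 D_reinhardt alpha_PSh).
    by apply/eqP => /alpha_inj/eqP; rewrite eqn_leq ltnn.
  by exists (support_value D alpha n.+1), (support_value D alpha n); exact: logW.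
- split=> // n; rewrite logW !supporting_half_spaceE//.
    by apply: alpha_PSh; exists n.
  by apply: alpha_PSh; exists n.+1.
- have [[_ oD _] _] := D_reinhardt; split=> // [n|U oU Uconv].
    by move=> z /(sub_domain g D_reinhardt alpha_PSh n)/interior_subset.
  (* An open set contained in every set of absolute convergence is contained in every interior,
     hence in the interior of their intersection. *)
  rewrite -capD -((interior_id U).1 oU); apply: interiorS => z Uz n _.
  by move: z Uz; rewrite -((interior_id U).1 oU); apply: interiorS; exact: Uconv.
- by move=> z Dz; exact: wedge_series_sum.
Qed.
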